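(* Let $R$ be a ring. Then $R$ is a UnitUC ring if and only if both of the following hold: (1) $R$ is an exchange ring; (2) $R/J(R)$ is a Boolean ring.
   Context: Rings are associative with $1\neq 0$; $J(R)$ denotes the Jacobson radical, $U(R)$ the group of units, $Id(R)$ the set of idempotents of $R$. A ring $R$ is clean if every $a\in R$ can be written as $a=e+u$ with $e\in Id(R)$, $u\in U(R)$. For $e,f\in Id(R)$ write $e\sim f$ if there is $u\in U(R)$ with $e=u^{-1}fu$. A ring $R$ is unit uniquely clean (UnitUC) if it is clean and, whenever $e+u=f+v$ with $e,f\in Id(R)$ and $u,v\in U(R)$, one has $e\sim f$. Exchange ring is meant in the standard sense (for every $a\in R$ there is an idempotent $e\in aR$ with $1-e\in(1-a)R$). *)

(* Defs.v *)
From HB Require Import structures.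
From mathcomp Require Import all_boot all_algebra.
From mathcomp Require Import boolp classical_sets.

Set Implicit Arguments.
Unset Strict Implicit.
Unset Printing Implicit Defensive.

Import GRing.Theory.
Local Open Scope ring_scope.
Local Open Scope classical_set_scope.
Local Open Scope quotient_scope.

Section RingNotions.
Variable R : pzRingType.
Implicit Types a e f u v : R.

Definition idempotent_elt e : Prop := e * e = e.

Definition inverse_of u v : Prop := u * v = 1 /\ v * u = 1.

(* Unlike GRing.unit, this needs no unitRingType structure on R. *)
Definition unit_elt u : Prop := exists v, inverse_of u v.

(* e = u^-1 f u, where v is the inverse of u. *)
Definition idem_conj e f : Prop :=
  exists u v, inverse_of u v /\ e = v * f * u.

Definition clean_ring : Prop :=
  forall a, exists e u, [/\ idempotent_elt e, unit_elt u & a = e + u].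

Definition unit_uniquely_clean_ring : Prop :=
  clean_ring /\
  forall e f u v, idempotent_elt e -> idempotent_elt f ->
    unit_elt u -> unit_elt v -> e + u = f + v -> idem_conj e f.

Definition exchange_ring : Prop :=
  forall a, exists e, [/\ idempotent_elt e,
    (exists r, e = a * r) & (exists s, 1 - e = (1 - a) * s)].

Definition boolean_ring : Prop := forall a, a * a = a.

Definition left_ideal (I : set R) : Prop :=
  [/\ I 0, (forall x y, I x -> I y -> I (x + y)) &
      (forall a x, I x -> I (a * x))].

Definition maximal_left_ideal (M : set R) : Prop :=
  [/\ left_ideal M, M <> setT &
      (forall I, left_ideal I -> M `<=` I -> I = M \/ I = setT)].

(* The intersection of all maximal left ideals, as a boolean predicate so that
   the quotient construction of ring_quotient applies. *)
Definition jacobson : {pred R} :=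
  fun x => `[< forall M : set R, maximal_left_ideal M -> M x >].

Lemma jacobsonP x :
  reflect (forall M : set R, maximal_left_ideal M -> M x) (x \in jacobson).
Proof. exact: asboolP. Qed.

Lemma jacobson_zmod_closed : zmod_closed jacobson.
Proof.
split=> [|x y /jacobsonP Jx /jacobsonP Jy]; apply/jacobsonP => M maxM.
  by case: maxM => -[].
have [[_ MD MM] _ _] := maxM.
by apply: MD; [exact: Jx | rewrite -mulN1r; apply: MM; exact: Jy].
Qed.

HB.instance Definition _ :=
  GRing.isZmodClosed.Build R jacobson jacobson_zmod_closed.

Lemma jacobsonMl a x : x \in jacobson -> a * x \in jacobson.
Proof.
move=> /jacobsonP Jx; apply/jacobsonP => M maxM.
by have [[_ _ MM] _ _] := maxM; apply: MM; exact: Jx.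
Qed.

Lemma left_ideal1 (I : set R) : left_ideal I -> I 1 -> I = setT.
Proof.
move=> [_ _ IM] I1; apply/seteqP; split=> // x _.
by rewrite -[x]mulr1; exact: IM.
Qed.

Lemma maximal_left_ideal_colon (M : set R) r : maximal_left_ideal M ->
  ~ M r -> maximal_left_ideal [set x | M (x * r)].
Proof.
move=> [[M0 MD MM] MT maxM] nMr; split.
- split=> /= [|x y Mx My|a x Mx]; first by rewrite mul0r.
    by rewrite mulrDl; exact: MD.
  by rewrite -mulrA; exact: MM.
- move=> NT; apply: nMr; have : [set x | M (x * r)] 1 by rewrite NT.
  by rewrite /= mul1r.
move=> I idI NI; have [I0 ID IM] := idI.
have [IN|] := pselect (I `<=` [set x | M (x * r)]).
  by left; apply/seteqP.
move=> /existsNP[y /not_implyP[Iy nMyr]]; right; apply: left_ideal1 => //.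
pose K := [set z | exists m a, M m /\ z = m + a * (y * r)].
have idK : left_ideal K.
  split=> [|_ _ [m [a [Mm ->]]] [m' [a' [Mm' ->]]]|b _ [m [a [Mm ->]]]].
  - by exists 0, 0; rewrite mul0r addr0.
  - by exists (m + m'), (a + a'); rewrite mulrDl addrACA; split=> //; exact: MD.
  - by exists (b * m), (b * a); rewrite mulrDr !mulrA; split=> //; exact: MM.
have MK : M `<=` K by move=> m Mm; exists m, 0; rewrite mul0r addr0.
have [KM|KT] := maxM _ idK MK.
  by case: nMyr; rewrite /= -KM; exists 0, 1; rewrite mul1r add0r.
have [m [a [Mm rE]]] : K r by rewrite KT.
have Iay : I (1 - a * y).
  by apply: NI => /=; rewrite mulrBl mul1r -mulrA {1}rE addrK.
by rewrite -[1](subrK (a * y)); apply: ID => //; exact: IM.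
Qed.

Lemma jacobsonMr x r : x \in jacobson -> x * r \in jacobson.
Proof.
move=> /jacobsonP Jx; apply/jacobsonP => M maxM.
have [Mr|nMr] := pselect (M r); first by have [[_ _ MM] _ _] := maxM; exact: MM.
exact: (Jx _ (maximal_left_ideal_colon maxM nMr)).
Qed.

(* ring_quotient supplies the additive group R / J(R), but a multiplication
   only for commutative R; it is added here, J(R) being two-sided. *)
Definition jacobson_quot : Type := Quotient.quot jacobson.

HB.instance Definition _ := GRing.Zmodule.on jacobson_quot.
HB.instance Definition _ :=
  EqQuotient.copy jacobson_quot (Quotient.quot jacobson).

Definition jq_one : jacobson_quot := \pi_jacobson_quot 1.
Definition jq_mul : jacobson_quot -> jacobson_quot -> jacobson_quot :=
  lift_op2 jacobson_quot *%R.

Lemma jq_piP x y : reflect (\pi_jacobson_quot x = \pi_jacobson_quot y)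
                           (x - y \in jacobson).
Proof. by rewrite Quotient.idealrBE; exact: eqP. Qed.

Lemma jq_pi_add : {morph \pi_jacobson_quot : x y / x + y}.
Proof. exact: (@Quotient.pi_add R jacobson). Qed.

Lemma jq_pi_mul : {morph \pi_jacobson_quot : x y / x * y >-> jq_mul x y}.
Proof.
move=> x y; unlock jq_mul; apply/jq_piP.
set x' := repr _; set y' := repr _.
have -> : x * y - x' * y' = x * (y - y') + (x - x') * y'.
  by rewrite mulrBr mulrBl addrA subrK.
apply: rpredD; [apply: jacobsonMl | apply: jacobsonMr].
  by apply/jq_piP; rewrite reprK.
by apply/jq_piP; rewrite reprK.
Qed.

Lemma jq_mulA : associative jq_mul.
Proof.
by move=> x y z; rewrite -[x]reprK -[y]reprK -[z]reprK -!jq_pi_mul mulrA.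
Qed.

Lemma jq_mul1l : left_id jq_one jq_mul.
Proof. by move=> x; rewrite -[x]reprK -jq_pi_mul mul1r. Qed.

Lemma jq_mul1r : right_id jq_one jq_mul.
Proof. by move=> x; rewrite -[x]reprK -jq_pi_mul mulr1. Qed.

Lemma jq_mulDl : left_distributive jq_mul +%R.
Proof.
move=> x y z; rewrite -[x]reprK -[y]reprK -[z]reprK.
by rewrite -jq_pi_add -!jq_pi_mul mulrDl jq_pi_add.
Qed.

Lemma jq_mulDr : right_distributive jq_mul +%R.
Proof.
move=> x y z; rewrite -[x]reprK -[y]reprK -[z]reprK.
by rewrite -jq_pi_add -!jq_pi_mul mulrDr jq_pi_add.
Qed.

HB.instance Definition _ := GRing.Zmodule_isPzRing.Build jacobson_quot
  jq_mulA jq_mul1l jq_mul1r jq_mulDl jq_mulDr.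

End RingNotions.

Arguments jacobson R : clear implicits.
Arguments jacobson_quot R : clear implicits.
Arguments clean_ring R : clear implicits.
Arguments unit_uniquely_clean_ring R : clear implicits.
Arguments exchange_ring R : clear implicits.
Arguments boolean_ring R : clear implicits.

(* Main.v *)
(* Forward direction: clean rings are exchange, and idempotents and units lift
   modulo J.  Comparing 0 + u with e + (u - e), a nonzero idempotent e of R/J is
   never a difference of two units.  A nonzero square-zero element of R/J would
   produce a corner containing 2x2 matrix units, where w = [[0,1],[1,1]] and
   w - 1 are both invertible; hence R/J is reduced and its idempotents are
   central.  A unit u <> 1 would then yield a nonzero idempotent e with ue and
   (u - 1)e both invertible in the corner of e, so 1 is the only unit, every
   element is of the form e + 1, and R/J is Boolean.
   Backward direction: idempotents lift modulo J, which gives cleanness, and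
   two idempotents e, f congruent modulo J are conjugate by ef + (1-e)(1-f). *)
Require Import Defs.
From mathcomp Require Import all_boot all_algebra.
From mathcomp Require Import boolp classical_sets.

Set Implicit Arguments.
Unset Strict Implicit.
Unset Printing Implicit Defensive.

Import GRing.Theory.
Local Open Scope ring_scope.
Local Open Scope classical_set_scope.
Local Open Scope quotient_scope.

(** * Idempotents, units and the Jacobson radical of a ring *)

Section PzRings.
Variable R : pzRingType.
Implicit Types a b e f r u v w x : R.

Lemma unit_elt_lr a b c : b * a = 1 -> a * c = 1 -> unit_elt a.
Proof.
move=> ba ac; have bc : b = c by rewrite -[b]mulr1 -ac mulrA ba mul1r.
by exists b; split; rewrite // bc.
Qed.

Lemma idempotentBl e : idempotent_elt e -> idempotent_elt (1 - e).
Proof.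
by rewrite /idempotent_elt => ee; rewrite mulrBl mul1r mulrBr mulr1 ee subrr subr0.
Qed.

Lemma idempotent_mulBr e : idempotent_elt e -> e * (1 - e) = 0.
Proof. by move=> ee; rewrite mulrBr mulr1 ee subrr. Qed.

Lemma idempotent_mulBl e : idempotent_elt e -> (1 - e) * e = 0.
Proof. by move=> ee; rewrite mulrBl mul1r ee subrr. Qed.

(** The inverse is [b + (1 - e)]: products across the complementary corners of [e] and [1 - e]
    vanish. *)
Lemma corner_unit_elt e a b : idempotent_elt e ->
  a * e = a -> e * a = a -> b * e = b -> e * b = b -> a * b = e -> b * a = e ->
  unit_elt (a + (1 - e)).
Proof.
move=> /idempotentBl; rewrite /idempotent_elt => ee ae ea be eb ab ba.
have aux c : c * e = c -> c * (1 - e) = 0 by move=> ce; rewrite mulrBr mulr1 ce subrr.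
have aux' c : e * c = c -> (1 - e) * c = 0 by move=> ce; rewrite mulrBl mul1r ce subrr.
have := (aux _ ae, aux _ be, aux' _ ea, aux' _ eb).
have : e + (1 - e) = 1 by rewrite addrC subrK.
move: (1 - e) ee => g gg e1 [[[ag bg] ga] gb].
by exists (b + g); split; rewrite mulrDl !mulrDr gg ?ag ?bg ?ga ?gb add0r addr0 ?ab ?ba.
Qed.

Lemma exists_maximal_left_ideal (L : set R) : left_ideal L -> ~ L 1 ->
  exists M, maximal_left_ideal M /\ L `<=` M.
Proof.
move=> idL nL1; have [L0 LD LM] := idL.
(* Uniting with L makes the union of the empty chain admissible. *)
pose P := [set A : set R | left_ideal (A `|` L) /\ ~ (A `|` L) 1].
have chainP F : F `<=` P -> total_on F subset -> P (\bigcup_(X in F) X).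
  move=> FP Ftot; split; last by move=> [[X FX X1]|//]; apply: (FP X FX).2; left.
  split; first by right.
    have key X x y : F X -> X x -> X y \/ L y ->
        ((\bigcup_(X in F) X) `|` L) (x + y).
      move=> FX Xx Xy; have [[_ XD _] _] := FP _ FX.
      by have [] := XD x y (or_introl Xx) Xy; [left; exists X|right].
    move=> x y [[X FX Xx]|Lx] [[Y FY Yy]|Ly].
    - have [XY|YX] := Ftot _ _ FX FY.
        by apply: (key Y) => //; [exact: XY|left].
      by apply: (key X) => //; left; exact: YX.
    - by apply: (key X) => //; right.
    - by rewrite addrC; apply: (key Y) => //; right.
    - by right; exact: LD.
  move=> a x [[X FX Xx]|Lx]; last by right; exact: LM.
  have [[_ _ XM] _] := FP _ FX.
  by have [] := XM a x (or_introl Xx); [left; exists X|right].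
have [A [[idA nA1] maxA]] := Zorn_bigcup chainP.
exists (A `|` L); split; last by move=> x; right.
split=> // [AT|I idI AI]; first by apply: nA1; rewrite AT.
have [I1|nI1] := pselect (I 1); first by right; exact: left_ideal1.
left; apply/seteqP; split=> // x Ix; left; apply: contrapT => nAx.
have IL : I `|` L = I.
  by apply/seteqP; split=> [y [//|Ly]|y]; [apply: AI; right|left].
apply: (maxA I); last by split; rewrite IL.
by split=> [y Ay|IA]; [apply: AI; left|exact: nAx (IA _ Ix)].
Qed.

(** Were the left ideal [R x] proper, some maximal left ideal would contain both [x] and [1 - x]. *)
Lemma jacobson_left_inv x : 1 - x \in jacobson R -> exists s, s * x = 1.
Proof.
move=> /jacobsonP Jx; pose L := [set y | exists s, y = s * x].
have idL : left_ideal L.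
  split; first by exists 0; rewrite mul0r.
    by move=> _ _ [s ->] [t ->]; exists (s + t); rewrite mulrDl.
  by move=> a _ [s ->]; exists (a * s); rewrite mulrA.
have [[s ->]|nL1] := pselect (L 1); first by exists s.
have [M [maxM LM]] := exists_maximal_left_ideal idL nL1.
have [idM MT _] := maxM; case: MT; apply: left_ideal1 => //.
rewrite -(subrK x 1); case: idM => _ MD _; apply: MD; first exact: Jx.
by apply: LM; exists 1; rewrite mul1r.
Qed.

(** The left inverse [s] of [x] is again 1 modulo J, so it has a left inverse too, which must be
    [x]. *)
Lemma jacobson_unit x : 1 - x \in jacobson R -> unit_elt x.
Proof.
move=> Jx; have [s sx] := jacobson_left_inv Jx.
have [|t ts] := @jacobson_left_inv s.
  have -> : 1 - s = - (s * (1 - x)) by rewrite mulrBr mulr1 sx opprB.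
  by rewrite rpredN; exact: jacobsonMl.
have tx : t = x by rewrite -[t]mulr1 -sx mulrA ts mul1r.
by exists s; split; rewrite // -tx.
Qed.

Lemma idempotent_jacobson e : idempotent_elt e -> e \in jacobson R -> e = 0.
Proof.
move=> ee Je; have [|v [ev _]] := @jacobson_unit (1 - e).
  by rewrite opprB addrC subrK.
by rewrite -[e]mulr1 -ev mulrA idempotent_mulBr // mul0r.
Qed.

(* 1 = m + r x with m in a maximal left ideal avoiding x. *)
Lemma notin_jacobson x : x \notin jacobson R ->
  exists r, forall s, s * (1 - r * x) <> 1.
Proof.
move=> /jacobsonP /existsNP[M /not_implyP[maxM nMx]].
have [[M0 MD MM] MT max] := maxM.
pose K := [set z | exists m a, M m /\ z = m + a * x].
have idK : left_ideal K.
  split=> [|_ _ [m [a [Mm ->]]] [m' [a' [Mm' ->]]]|b _ [m [a [Mm ->]]]].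
  - by exists 0, 0; rewrite mul0r addr0.
  - by exists (m + m'), (a + a'); rewrite mulrDl addrACA; split=> //; exact: MD.
  - by exists (b * m), (b * a); rewrite mulrDr !mulrA; split=> //; exact: MM.
have MK : M `<=` K by move=> m Mm; exists m, 0; rewrite mul0r addr0.
have [KM|KT] := max _ idK MK.
  by case: nMx; rewrite -KM; exists 0, 1; rewrite mul1r add0r.
have [m [r [Mm E]]] : K 1 by rewrite KT.
exists r => s s1; apply: MT; apply: left_ideal1 => //.
by rewrite -s1 E addrK; exact: MM.
Qed.

(* Nicholson's trick: for a = e + u take f = u^-1(1-e)u and g = u(1-e)u^-1. *)
Lemma clean_near_idempotent a : clean_ring R ->
  exists f g v, [/\ idempotent_elt f, idempotent_elt g,
    a - f = v * (a * a - a) & a - g = (a * a - a) * v].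
Proof.
move=> /(_ a)[e [u [ee [v [uv vu]] aE]]].
have ee' : (1 - e) * (1 - e) = 1 - e := idempotentBl ee.
have El : a * a - a = u * a - (1 - e) * u.
  have -> : (1 - e) * u = (1 - e) * a.
    by rewrite aE mulrDr idempotent_mulBl // add0r.
  by rewrite mulrBl mul1r opprB addrA -mulrDl [u + e]addrC -aE.
have Er : a * a - a = a * u - u * (1 - e).
  have -> : u * (1 - e) = a * (1 - e).
    by rewrite aE mulrDl idempotent_mulBr // add0r.
  by rewrite mulrBr mulr1 opprB addrA -mulrDr [u + e]addrC -aE.
exists (v * (1 - e) * u), (u * (1 - e) * v), v; split.
- by rewrite /idempotent_elt !mulrA -(mulrA _ u v) uv mulr1 -(mulrA v) ee'.
- by rewrite /idempotent_elt !mulrA -(mulrA _ v u) vu mulr1 -(mulrA u) ee'.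
- by rewrite El [RHS]mulrBr !mulrA vu mul1r.
- by rewrite Er [RHS]mulrBl -(mulrA a) uv mulr1.
Qed.

Lemma clean_exchange : clean_ring R -> exchange_ring R.
Proof.
move=> cleanR a; have [_ [g [v [_ gg _ ag]]]] := clean_near_idempotent a cleanR.
have gE : g = a - (a * a - a) * v by rewrite -ag opprB addrC subrK.
exists g; split=> //.
  by exists (1 - (a - 1) * v); rewrite gE mulrBr mulr1 mulrA [a * (a - 1)]mulrBr mulr1.
exists (1 - a * v); rewrite gE opprB addrCA addrC mulrBr mulr1; congr (_ + _).
by rewrite mulrA [in RHS]mulrBl mul1r -mulNr opprB.
Qed.

(* R/J is semipotent: r x and x r are idempotents outside J. *)
Lemma clean_semipotent x : clean_ring R -> x \notin jacobson R ->
  exists r, r * x * r = r /\ r \notin jacobson R.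
Proof.
move=> cleanR /notin_jacobson[r Hr].
have [f [_ [v [ff _ af _]]]] := clean_near_idempotent (r * x) cleanR.
set a := r * x in Hr af.
have fE : f = a - v * (a * a - a) by rewrite -af opprB addrC subrK.
(* Since [f = (1 - v * (a - 1)) * a] with [a = r * x], this choice gives [t * x = f * f = f]. *)
pose t := f * (1 - v * (a - 1)) * r.
have tx : t * x = f.
  rewrite /t -[RHS]ff [X in _ = f * X]fE -[f * _ * r * x]mulrA -/a.
  rewrite -[f * _ * a]mulrA; congr (_ * _).
  by rewrite mulrBl mul1r -mulrA [(a - 1) * a]mulrBl mul1r.
exists t; split; first by rewrite tx !mulrA ff.
apply/negP => Jt; have f0 : f = 0.
  by apply: idempotent_jacobson ff _; rewrite -tx jacobsonMr.
(* If [f = 0], then [a = v * (a * a - a)], which makes [1 - v * a] a left inverse of [1 - a]. *)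
apply: (Hr (1 - v * a)); rewrite mulrDl mul1r mulNr -mulrA mulrBr mulr1.
by rewrite -mulrN opprB -af f0 subr0 subrK.
Qed.

(** With [e] in [a R] and [1 - e] in [(1 - a) R], both terms of [a - e = a(1 - e) - (1 - a)e] are
    multiples of [a * a - a] up to sign. *)
Lemma exchange_lift_idempotent a : exchange_ring R -> a * a - a \in jacobson R ->
  exists e, idempotent_elt e /\ a - e \in jacobson R.
Proof.
move=> /(_ a)[e [ee [r er] [s es]]] Ja; exists e; split=> //.
have -> : a - e = a * (1 - e) + (a * e - e) by rewrite mulrBr mulr1 addrA subrK.
apply: rpredD; last first.
  have -> : a * e - e = (a * a - a) * r by rewrite mulrBl -mulrA -er.
  exact: jacobsonMr.
by rewrite es mulrA mulrBr mulr1 -opprB mulNr rpredN jacobsonMr.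
Qed.

(** The element [w] is 1 modulo J, hence a unit, and it intertwines the idempotents:
    [e w = e f = w f]. *)
Lemma idem_conj_jacobson e f : idempotent_elt e -> idempotent_elt f ->
  e - f \in jacobson R -> idem_conj e f.
Proof.
move=> ee ff Jef; pose w := e * f + (1 - e) * (1 - f).
have [|v [wv vw]] := @jacobson_unit w.
  have -> : 1 - w = e * (e - f) + (1 - e) * (f - e).
    rewrite [e * _]mulrBr [(1 - e) * (f - e)]mulrBr ee idempotent_mulBl // subr0.
    rewrite /w [_ * (1 - f)]mulrBr mulr1 opprD opprB [_ * f - _]addrC !addrA.
    by rewrite (addrAC 1) opprB addrCA subrr addr0.
  by apply: rpredD; apply: jacobsonMl; rewrite // -opprB rpredN.
have ew : e * w = e * f.
  by rewrite /w [LHS]mulrDr !mulrA ee idempotent_mulBr // mul0r addr0.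
have wf : w * f = e * f.
  by rewrite /w [LHS]mulrDl -!mulrA ff idempotent_mulBl // mulr0 addr0.
by exists v, w; rewrite wf -ew -mulrA wv mulr1.
Qed.

Lemma boolean_unit_jacobson u : u * u - u \in jacobson R -> unit_elt u ->
  u - 1 \in jacobson R.
Proof.
move=> Ju [v [uv vu]].
have -> : u - 1 = v * (u * u - u) by rewrite mulrBr mulrA vu mul1r.
exact: jacobsonMl.
Qed.

End PzRings.

(** * Rings in which no nonzero idempotent is a difference of two units *)

Section UnitDifferences.
Variable S : pzRingType.
Hypothesis unit_diff :
  forall e u : S, idempotent_elt e -> unit_elt u -> unit_elt (u - e) -> e = 0.
Implicit Types a b c e p q r u x y : S.

(** Adding [1 - e] turns the corner units [a] and [a - e], with corner inverses [b] and [c], into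
    units of [S] that differ by [e]. *)
Lemma corner_unit_diff e a b c : idempotent_elt e ->
  a * e = a -> e * a = a -> b * e = b -> e * b = b -> a * b = e -> b * a = e ->
  c * e = c -> e * c = c -> (a - e) * c = e -> c * (a - e) = e -> e = 0.
Proof.
move=> ee ae ea be eb ab ba ce ec ac ca.
apply: (unit_diff (u := a + (1 - e))) => //; first exact: corner_unit_elt ab ba.
rewrite addrAC; apply: corner_unit_elt ac ca => //.
  by rewrite mulrBl ae ee.
by rewrite mulrBr ea ee.
Qed.

(* p, q, pq, qp are 2x2 matrix units e12, e21, e11, e22; the units used are
   w = e12 + e21 + e22 and w - 1, and w(w - 1) = 1. *)
Lemma matrix_units_eq0 p q : p * p = 0 -> q * q = 0 ->
  p * q * p = p -> q * p * q = q -> p = 0.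
Proof.
move=> pp qq pqp qpq.
(* [g] is e11 + e22, the identity of the corner in which [w] and [w - g] are mutually inverse. *)
pose g := p * q + q * p; pose w := p + q + q * p.
have gp : g * p = p by rewrite mulrDl pqp -mulrA pp mulr0 addr0.
have gq : g * q = q by rewrite mulrDl qpq -mulrA qq mulr0 add0r.
have pg : p * g = p by rewrite mulrDr !mulrA pqp pp mul0r add0r.
have qg : q * g = q by rewrite mulrDr !mulrA qpq qq mul0r addr0.
have gg : g * g = g by rewrite {2}/g mulrDr !mulrA gp gq.
have gw : g * w = w by rewrite !mulrDr mulrA gp gq.
have wg : w * g = w by rewrite !mulrDl -mulrA pg qg.
have pw : p * w = p * q + p by rewrite !mulrDr mulrA pp pqp add0r.
have qw : q * w = q * p by rewrite !mulrDr mulrA qq mul0r addr0 addr0.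
have qpw : q * p * w = q + q * p.
  by rewrite !mulrDr -mulrA pp mulr0 add0r qpq mulrA qpq.
have ww : w * w = w + g.
  by rewrite {1}/w !mulrDl pw qw qpw [LHS](AC (3*2) ((2*4*3)*(1*5))).
have wwg : w * (w - g) = g by rewrite mulrBr ww wg addrC addKr.
have wgw : (w - g) * w = g by rewrite mulrBl ww gw addrC addKr.
have g0 : g = 0.
  by apply: (corner_unit_diff (a := w) (b := w - g) (c := w)) => //;
     rewrite ?mulrBl ?mulrBr ?gg ?wg ?gw.
by rewrite -pg g0 mulr0.
Qed.

Hypothesis semipotent : forall x, x <> 0 -> exists r, r * x * r = r /\ r <> 0.

Lemma unit_diff_reduced x : x * x = 0 -> x = 0.
Proof.
move=> xx; apply: contrapT => /semipotent[r [rxr]]; apply.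
have rb : r * (1 - x * r) = 0 by rewrite mulrBr mulr1 mulrA rxr subrr.
have xe : x * r * (x * r) = x * r by rewrite -mulrA (mulrA r) rxr.
(* The matrix units are [p = x r x] and [q = (1 - x r) r]. The factor [1 - x r] forces [q q = 0]
   because [r (1 - x r) = 0], and it leaves [p q = x r] because [x x = 0]. *)
have pq : x * r * x * ((1 - x * r) * r) = x * r.
  by rewrite mulrA mulrBr mulr1 !mulrA -(mulrA _ x x) xx mulr0 !mul0r subr0 -mulrA xe.
suff x0 : x * r * x = 0.
  have -> : r = r * (x * r * x) * r by rewrite !mulrA !rxr.
  by rewrite x0 mulr0 mul0r.
apply: (@matrix_units_eq0 _ ((1 - x * r) * r)).
- by rewrite -!mulrA (mulrA x x) xx !mul0r !mulr0.
- by rewrite -mulrA (mulrA r) rb mul0r mulr0.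
- by rewrite pq mulrA xe.
- by rewrite -mulrA pq -!mulrA [r * (x * r)]mulrA rxr.
Qed.

(** The off-diagonal parts [e y (1 - e)] and [(1 - e) y e] square to zero. *)
Lemma unit_diff_central e y : idempotent_elt e -> e * y = y * e.
Proof.
move=> ee.
have l : e * y * (1 - e) = 0.
  apply: unit_diff_reduced.
  by rewrite !mulrA -(mulrA _ _ e) idempotent_mulBl // mulr0 !mul0r.
have r : (1 - e) * y * e = 0.
  apply: unit_diff_reduced.
  by rewrite !mulrA -(mulrA _ e) idempotent_mulBr // mulr0 !mul0r.
have ey : e * y = e * y * e.
  by apply/eqP; rewrite -subr_eq0 -[X in X - _]mulr1 -mulrBr l.
have ye : y * e = e * y * e.
  by apply/eqP; rewrite -subr_eq0 -[X in X - _]mul1r -!mulrA -mulrBl mulrA r.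
by rewrite ey ye.
Qed.

Lemma unit_diff_unipotent u : unit_elt u -> u = 1.
Proof.
move=> [v [uv vu]]; apply/eqP; rewrite -subr_eq0; apply/eqP; set x := u - 1.
apply: contrapT => /semipotent[r [rxr]]; apply.
have ee : idempotent_elt (x * r) by rewrite /idempotent_elt -mulrA (mulrA r) rxr.
have ff : idempotent_elt (r * x) by rewrite /idempotent_elt mulrA rxr.
(* Both idempotents are central, which makes each equal to the product of the two. *)
have xr : x * r = r * x.
  have fe : x * r = r * x * (x * r).
    by rewrite -[LHS]ee [RHS]mulrA (unit_diff_central x ff) !mulrA.
  have ef : r * x = x * r * (r * x).
    by rewrite -[LHS]ff [RHS]mulrA (unit_diff_central r ee) !mulrA.
  by rewrite [LHS]fe [RHS]ef; exact: unit_diff_central.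
have re : r * (x * r) = r by rewrite mulrA.
have [e eE] : exists e, e = x * r by exists (x * r).
rewrite -eE in ee xr re.
have eM y z : (e * y) * (e * z) = e * (y * z).
  by rewrite -mulrA (mulrA y) -(unit_diff_central y ee) !mulrA ee.
have eMr y : e * y * e = e * y by rewrite -[X in _ * X]mulr1 eM mulr1.
have eMl y : e * (e * y) = e * y by rewrite mulrA ee.
suff e0 : e = 0 by rewrite -re e0 mulr0.
(* Here [e u - e = e x], whose inverse in the corner is [e r] since [x r = r x = e]. *)
apply: (corner_unit_diff (a := e * u) (b := e * v) (c := e * r)) => //.
- by rewrite eM uv mulr1.
- by rewrite eM vu mulr1.
- by rewrite -[X in _ - X]mulr1 -mulrBr eM -/x -eE ee.
- by rewrite -[X in _ - X]mulr1 -mulrBr eM -/x -xr ee.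
Qed.

Lemma unit_diff_boolean : clean_ring S -> boolean_ring S.
Proof.
move=> cleanS a; have [e [u [ee /unit_diff_unipotent -> E]]] := cleanS (a + 1).
by have -> : a = e by apply: (addIr 1).
Qed.

End UnitDifferences.

(** * Transfer between R and R/J, and the two implications *)

Section JacobsonQuotient.
Variable R : pzRingType.
Notation Q := (jacobson_quot R).
Notation pi := (\pi_Q : R -> Q).

Lemma jq_pi1 : pi 1 = 1.
Proof. by []. Qed.

(* jq_pi_mul is stated with jq_mul, this one with the ring product of R/J. *)
Lemma jq_piM : {morph pi : x y / x * y}.
Proof. exact: jq_pi_mul. Qed.

Lemma jq_boolean : boolean_ring Q <-> forall a : R, a * a - a \in jacobson R.
Proof.
split=> [bool a|bool a]; first by apply/jq_piP; rewrite jq_piM; exact: bool.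
rewrite -[a]reprK; have /jq_piP := bool (repr a).
by rewrite jq_piM.
Qed.

Lemma jq_pi0 : pi 0 = 0.
Proof. by apply: (addIr (pi 0)); rewrite -jq_pi_add !add0r. Qed.

Lemma jq_pi_sub : {morph pi : x y / x - y}.
Proof. by move=> x y; apply: (addIr (pi y)); rewrite -jq_pi_add !subrK. Qed.

Lemma jq_pi_eq0 x : pi x = 0 <-> x \in jacobson R.
Proof. by rewrite -jq_pi0 -[X in X \in _]subr0; split=> /jq_piP. Qed.

(** If [y] represents the inverse, [x y] and [y x] are 1 modulo J, hence units, so [x] is invertible
    on both sides. *)
Lemma jq_unit_lift x : unit_elt (pi x) -> unit_elt x.
Proof.
move=> [w]; rewrite -[w]reprK; move: (repr w) => y [].
rewrite -!jq_piM -jq_pi1 => /esym/jq_piP/jacobson_unit[s [xys _]].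
move=> /esym/jq_piP/jacobson_unit[t [_ tyx]].
by apply: (@unit_elt_lr _ _ (t * y) (y * s)); [rewrite -mulrA|rewrite mulrA].
Qed.

Lemma jq_unit x : unit_elt x -> unit_elt (pi x).
Proof. by move=> [v [xv vx]]; exists (pi v); split; rewrite -jq_piM ?xv ?vx. Qed.

Lemma jq_clean : clean_ring R -> clean_ring Q.
Proof.
move=> cleanR x; have [e [u [ee uu xE]]] := cleanR (repr x).
exists (pi e), (pi u); split; last by rewrite -jq_pi_add -xE reprK.
  by rewrite /idempotent_elt -jq_piM ee.
exact: jq_unit.
Qed.

Lemma jq_semipotent (x : Q) : clean_ring R -> x <> 0 ->
  exists r, r * x * r = r /\ r <> 0.
Proof.
move=> cleanR; rewrite -[x]reprK; move: (repr x) => a a0.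
have [|r [rar Jr]] := @clean_semipotent _ a cleanR.
  by apply/negP => /jq_pi_eq0.
exists (pi r); rewrite -!jq_piM rar; split=> // /jq_pi_eq0.
exact/negP.
Qed.

Lemma jq_unit_diff (e u : Q) : unit_uniquely_clean_ring R ->
  idempotent_elt e -> unit_elt u -> unit_elt (u - e) -> e = 0.
Proof.
rewrite -[e]reprK -[u]reprK; move: (repr e) (repr u) => a b [cleanR uniqR].
rewrite /idempotent_elt -jq_piM => /jq_piP Ja /jq_unit_lift ub.
have [f [_ [v [ff _ af _]]]] := clean_near_idempotent a cleanR.
have -> : pi a = pi f by apply/jq_piP; rewrite af; exact: jacobsonMl.
rewrite -jq_pi_sub => /jq_unit_lift ubf.
(* With [e] and [u] lifted to an idempotent [f] and a unit [b], comparing [0 + b = f + (b - f)]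
   makes [f] conjugate to 0. *)
have [||s [t [[st _]]]] := uniqR 0 f b (b - f) _ ff ub ubf.
- exact: mul0r.
- by rewrite add0r addrC subrK.
move=> tfs; have -> : f = s * (t * f * s) * t.
  by rewrite !mulrA st mul1r -mulrA st mulr1.
by rewrite -tfs mulr0 mul0r jq_pi0.
Qed.

Lemma unit_uniquely_clean_boolean :
  unit_uniquely_clean_ring R -> boolean_ring Q.
Proof.
move=> uucR; have [cleanR _] := uucR; apply: unit_diff_boolean.
- by move=> e u; exact: jq_unit_diff.
- by move=> x; exact: jq_semipotent.
- exact: jq_clean.
Qed.

Lemma exchange_boolean_unit_uniquely_clean :
  exchange_ring R -> boolean_ring Q -> unit_uniquely_clean_ring R.
Proof.
move=> exR /jq_boolean boolR; split=> [a|e f u v ee ff uu uv euv].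
  have [e [ee Jae]] := exchange_lift_idempotent exR (boolR a).
  (* Modulo J, [a] is [e] and 2 is 0, so [a - (1 - e)] is [2 e - 1], that is 1. *)
  exists (1 - e), (a - (1 - e)); split; last by rewrite addrC subrK.
    exact: idempotentBl.
  apply: jacobson_unit.
  have -> : 1 - (a - (1 - e)) = ((1 - e) + (1 - e)) - (a - e).
    by rewrite !opprB addrACA subrK.
  apply: rpredB => //; move: (1 - e) => x.
  have -> : x + x = ((- x) * (- x) - - x) - (x * x - x).
    by rewrite mulrNN opprK opprB [x * x + x]addrC addrACA subrr addr0.
  exact: rpredB.
apply: idem_conj_jacobson => //.
(* Every unit is 1 modulo J, so the difference of the two idempotents lies in J. *)
have -> : e - f = (v - 1) - (u - 1).
  by rewrite opprB addrA subrK -[e](addrK u) euv addrAC [f + v]addrC addrK.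
by apply: rpredB; exact: boolean_unit_jacobson.
Qed.

End JacobsonQuotient.

Theorem theorem2p20 (R : nzRingType) :
  unit_uniquely_clean_ring R <->
  exchange_ring R /\ boolean_ring (jacobson_quot R).
Proof.
split=> [uucR|[exR boolR]]; last exact: exchange_boolean_unit_uniquely_clean.
split; last exact: unit_uniquely_clean_boolean.
by have [cleanR _] := uucR; exact: clean_exchange.
Qed.
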